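(* Let $p$ be a prime and let $G=D_{2p}$. Then $$\mathrm{Spec}(\mathcal{B}(G))=\left\{(0)^{4p^2-p-3}, (-1)^1, (1)^1, (\sqrt{3})^p, (-\sqrt{3})^p, (\sqrt{p^2-1})^1, (-\sqrt{p^2-1})^1, (\sqrt{3p^2-3p})^1, (-\sqrt{3p^2-3p})^1\right\},$$ $$\mathrm{L\text{-}spec}(\mathcal{B}(G))=\left\{(0)^{p+3}, (1)^{4p^2-p-3}, (2)^1, (4)^p, (p^2)^1, (3p^2-3p+1)^1\right\}=\mathrm{Q\text{-}spec}(\mathcal{B}(G)),$$ and $$\mathrm{CN\text{-}spec}(\mathcal{B}(G))=\left\{(0)^{p+4}, (-1)^{4p^2-p-3}, (2)^p, (p^2-2)^1, (3p^2-3p-1)^1\right\}.$$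
   Context: $D_{2m}=\langle a,b : a^m=b^2=1,\ bab=a^{-1}\rangle$ is the dihedral group of order $2m$ (for $m=2$ it is the group of order $4$ given by this presentation). For a finite group $G$, let $L(G)$ be the set of all subgroups of $G$. The subgroup generating bipartite graph $\mathcal{B}(G)$ is the simple bipartite graph with vertex set the disjoint union of $G\times G$ and $L(G)$, in which $(a,b)\in G\times G$ and $H\in L(G)$ are adjacent if and only if $H$ is the subgroup generated by $a$ and $b$ (and there are no other edges). For a finite simple graph $\Gamma$ with vertices $v_1,\dots,v_n$, let $A$ be its adjacency matrix and $D$ its diagonal degree matrix. $\mathrm{Spec}(\Gamma)$, $\mathrm{L\text{-}spec}(\Gamma)$ and $\mathrm{Q\text{-}spec}(\Gamma)$ denote the multisets of eigenvalues (with multiplicity) of $A$, $D-A$ and $D+A$ respectively. The common neighborhood matrix $CN(\Gamma)$ has $(i,j)$ entry, for $i\ne j$, equal to the number of vertices other than $v_i,v_j$ adjacent to both $v_i$ and $v_j$, and zero diagonal; $\mathrm{CN\text{-}spec}(\Gamma)$ is the multiset of its eigenvalues. The notation $\{(x_1)^{n_1},\dots,(x_k)^{n_k}\}$ denotes the multiset in which $x_i$ is listed $n_i$ times; if some $x_i$ coincide for a particular $p$, their multiplicities are added. *)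

(* Defs.v *)
From mathcomp Require Import all_boot all_order all_fingroup all_algebra.
From mathcomp Require Import all_solvable.
From mathcomp Require Import finmap multiset.

Set Implicit Arguments.
Unset Strict Implicit.
Unset Printing Implicit Defensive.

Import GRing.Theory Num.Theory.
Local Open Scope ring_scope.

Record sgraph := SGraph {
  vertex : finType;
  edge : rel vertex;
  edge_sym : symmetric edge;
  edge_irr : irreflexive edge }.

(* The eigenvalues are taken in an algebraically closed field, so that the    *)
(* roots of the characteristic polynomial, counted with multiplicity, are all *)
(* of them.                                                                   *)
Definition eigenvalues (C : numClosedFieldType) n (A : 'M[C]_n) : {mset C}%mset :=
  seq_mset (sval (closed_field_poly_normal (char_poly A))).

Lemma eigenvaluesP (C : numClosedFieldType) n (A : 'M[C]_n) (s : seq C) :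
  char_poly A = \prod_(x <- s) ('X - x%:P) <-> eigenvalues A = seq_mset s.
Proof.
rewrite /eigenvalues; case: closed_field_poly_normal => r /=.
rewrite (monicP (char_poly_monic A)) scale1r => ->; split=> [eq_rs | /eq_seq_msetP].
  by apply/eq_seq_msetP; apply: prod_XsubC_eq.
by apply: perm_big.
Qed.

(* The multiset {(x_1)^(n_1), ..., (x_k)^(n_k)}: multiplicities of equal      *)
(* elements add up.                                                           *)
Definition mset_pow (K : choiceType) (s : seq (K * nat)) : {mset K}%mset :=
  seq_mset (flatten [seq nseq xn.2 xn.1 | xn <- s]).

Section Spectra.
Variables (C : numClosedFieldType) (Gamma : sgraph).
Let V := vertex Gamma.
Implicit Types v w : V.

Definition degree v : nat := #|[set w : V | edge v w]|.

Definition common_nbr v w : {set V} :=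
  [set u | [&& u != v, u != w, edge v u & edge w u]].

Definition adj_mx : 'M[C]_#|V| :=
  \matrix_(i, j) (edge (enum_val i : V) (enum_val j))%:R.

Definition deg_mx : 'M[C]_#|V| := diag_mx (\row_i (degree (enum_val i))%:R).

Definition cn_mx : 'M[C]_#|V| :=
  \matrix_(i, j)
    if i == j then 0 else #|common_nbr (enum_val i) (enum_val j)|%:R.

Definition spec := eigenvalues adj_mx.
Definition Lspec := eigenvalues (deg_mx - adj_mx).
Definition Qspec := eigenvalues (deg_mx + adj_mx).
Definition CNspec := eigenvalues cn_mx.

End Spectra.

Section SubgroupGeneratingBipartiteGraph.
Variable gT : finGroupType.

(* The group is the whole of gT, so that {group gT} is its set of subgroups.  *)
Definition sgb_vertex : finType := ((gT * gT) + {group gT})%type.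

Definition sgb_edge : rel sgb_vertex := fun u v =>
  match u, v with
  | inl (a, b), inr H => H :==: <<[set a; b]>>%g
  | inr H, inl (a, b) => H :==: <<[set a; b]>>%g
  | _, _ => false
  end.

Lemma sgb_edge_sym : symmetric sgb_edge.
Proof. by move=> [[a b]|H] [[c d]|K]. Qed.

Lemma sgb_edge_irr : irreflexive sgb_edge.
Proof. by move=> [[a b]|H]. Qed.

Definition sgb_graph : sgraph := SGraph sgb_edge_sym sgb_edge_irr.

End SubgroupGeneratingBipartiteGraph.

(* Main.v *)
Require Import Defs.
From mathcomp Require Import all_boot all_order all_fingroup all_algebra.
From mathcomp Require Import all_solvable.
From mathcomp Require Import finmap multiset.
From mathcomp Require Import ring zify.

Set Implicit Arguments.
Unset Strict Implicit.
Unset Printing Implicit Defensive.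

Import GRing.Theory Num.Theory.
Local Open Scope ring_scope.

(** Each pair of group elements generates exactly one subgroup, so every pair
has degree one and the graph is a disjoint union of stars, one for each
subgroup [H], with [n_H] leaves, where [n_H] counts the pairs that generate
[H]. All four spectra are therefore functions of the family [n_H].

Order the vertices with the pairs before the subgroups, and let [B] be the
incidence matrix of the two classes. The adjacency and the two Laplacian
matrices have the characteristic matrix [[a I, b B; b B^T, D]] with [a] scalar
and [D] diagonal. As each pair lies over one subgroup, [B^T B] is the diagonal
matrix of the [n_H], so that eliminating the large scalar block leaves a
diagonal determinant ([det_star_forest]). Two distinct pairs have one common
neighbour when they generate the same subgroup and none otherwise, so the
common neighbourhood matrix is [B B^T - I] on pairs and [0] on subgroups; the
determinant of [a I - B B^T] reduces to the previous one by eliminating in the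
other order ([det_same_fibre]).

In these identities both sides carry a power of [a]: when some [n_H] vanish
there may be more subgroups than pairs, and they hold for every finite group.
For the dihedral group the powers cancel, because [a] is a nonzero polynomial.

It remains to find the family [n_H]. Let [P] be the group of rotations, of
prime order [p]. A subgroup other than [1], [P] and [G] meets [P] trivially,
hence has order two and is generated by one of the [p] reflections
([big_subgroups_index2]); this covers [p = 2] as well. A group of prime order
[q] is generated by all its pairs but one, which gives [n_H = 3] for the
reflections and [n_P = p^2 - 1]. The [n_H] add up to the number [4 p^2] of all
pairs, which gives [n_G = 3 p^2 - 3 p]. *)

(** * Block determinants *)

(** Schur complement of a scalar block. Clearing the upper right block by the
column operation that multiplies by [a] and not by its inverse keeps the
identity valid over any commutative ring, such as polynomials. *)
Lemma det_block_scalar_ul (R : comNzRingType) m n (a : R) (B : 'M_(m, n))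
    (B' : 'M_(n, m)) (D : 'M_n) :
  a ^+ n * \det (block_mx a%:M B B' D) = a ^+ m * \det (a *: D - B' *m B).
Proof.
have /(congr1 determinant) : block_mx a%:M B B' D *m block_mx 1%:M (- B) 0 a%:M
    = block_mx a%:M 0 B' (a *: D - B' *m B).
  rewrite mulmx_block !mulmx0 !mulmx1 !addr0 mul_scalar_mx mul_mx_scalar.
  by rewrite scalerN addNr mul_mx_scalar mulmxN [- _ + _]addrC.
by rewrite det_mulmx det_lblock det_ublock det1 mul1r !det_scalar mulrC.
Qed.

Lemma det_block_1_dr (R : comNzRingType) m n (A : 'M[R]_m) (B : 'M_(m, n))
    (B' : 'M_(n, m)) :
  \det (block_mx A B B' 1%:M) = \det (A - B *m B').
Proof.
have /(congr1 determinant) : block_mx A B B' 1%:M *m block_mx 1%:M 0 (- B') 1%:M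
    = block_mx (A - B *m B') B 0 1%:M.
  by rewrite mulmx_block !mulmx0 !mulmx1 !add0r mul1mx mulmxN subrr.
by rewrite det_mulmx det_lblock det_ublock !det1 !mulr1.
Qed.

(** * Matrices indexed by finite types *)

(** Two enumerations of the same type differ by a permutation, which acts on
rows and columns at once, so its sign occurs twice. *)
Lemma det_reindex (R : comNzRingType) (V : finType) m n
    (g : 'I_m -> V) (h : 'I_n -> V) (F : V -> V -> R) :
    bijective g -> bijective h ->
  \det (\matrix_(i, j) F (g i) (g j)) = \det (\matrix_(i, j) F (h i) (h j)).
Proof.
move=> bij_g bij_h.
have eq_mn : n = m.
  by rewrite -(card_ord m) -(card_ord n) (bij_eq_card bij_g) (bij_eq_card bij_h).
subst n.
case: bij_h => h' hK h'K.
have inj_s : injective (h' \o g).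
  by apply: inj_comp (bij_inj bij_g); apply: can_inj h'K.
pose s := perm inj_s.
have -> : \matrix_(i, j) F (g i) (g j)
        = row_perm s (col_perm s (\matrix_(i, j) F (h i) (h j))).
  by apply/matrixP => i j; rewrite !mxE !permE /= !h'K.
rewrite row_permE col_permE !det_mulmx !det_perm mulrCA mulrA -mulrA.
by rewrite -signr_addb odd_permV addbb mulr1.
Qed.

(** The enumeration of a sum type that lists the left summand first, so that
matrices over the sum become block matrices. *)
Definition sum_val (X Y : finType) (k : 'I_(#|X| + #|Y|)) : X + Y :=
  match split k with inl i => inl (enum_val i) | inr j => inr (enum_val j) end.

Lemma sum_val_lshift (X Y : finType) i :
  sum_val (lshift _ i) = inl (enum_val i) :> X + Y.
Proof. by rewrite /sum_val (unsplitK (inl i)). Qed.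

Lemma sum_val_rshift (X Y : finType) i :
  sum_val (rshift _ i) = inr (enum_val i) :> X + Y.
Proof. by rewrite /sum_val (unsplitK (inr i)). Qed.

Lemma sum_val_bij (X Y : finType) : bijective (@sum_val X Y).
Proof.
apply: inj_card_bij => [k l|]; last by rewrite card_sum card_ord.
rewrite /sum_val -{2}[k]splitK -{2}[l]splitK.
by case: (split k) (split l) => [i|i] [j|j] // [] /enum_val_inj ->.
Qed.

Definition sum_block (R X Y : Type) (A : X -> X -> R) (B : X -> Y -> R)
    (B' : Y -> X -> R) (D : Y -> Y -> R) (u v : X + Y) : R :=
  match u, v with
  | inl x, inl x' => A x x'
  | inl x, inr y => B x y
  | inr y, inl x => B' y x
  | inr y, inr y' => D y y'
  end.

Definition fun_mx (R : Type) (V W : finType) (F : V -> W -> R) : 'M[R]_(#|V|, #|W|) :=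
  \matrix_(i, j) F (enum_val i) (enum_val j).

Lemma det_sum_block (R : comNzRingType) (X Y : finType)
    (A : X -> X -> R) B B' (D : Y -> Y -> R) :
  \det (fun_mx (sum_block A B B' D)) =
  \det (block_mx (fun_mx A) (fun_mx B) (fun_mx B') (fun_mx D)).
Proof.
rewrite /fun_mx (det_reindex _ (enum_val_bij _) (sum_val_bij X Y)).
congr (\det _); apply/matrixP => i j; rewrite mxE.
rewrite -[i]splitK -[j]splitK.
by case: (split i) => i'; case: (split j) => j' /=;
  rewrite ?sum_val_lshift ?sum_val_rshift
    ?(block_mxEul, block_mxEur, block_mxEdl, block_mxEdr) mxE.
Qed.

Lemma fun_mx_scalar (R : comNzRingType) (V : finType) (a : R) :
  fun_mx (fun v w : V => a *+ (v == w)) = a%:M.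
Proof. by apply/matrixP => i j; rewrite !mxE (inj_eq enum_val_inj). Qed.

Lemma det_fun_diag (R : comNzRingType) (V : finType) (d : V -> R) :
  \det (fun_mx (fun v w : V => d v *+ (v == w))) = \prod_v d v.
Proof.
rewrite [RHS](reindex _ (onW_bij _ (enum_val_bij _))) /=.
transitivity (\prod_i (\row_i d (@enum_val V V i)) 0 i); last first.
  by apply: eq_bigr => i _; rewrite mxE.
rewrite -det_diag; congr (\det _); apply/matrixP => i j.
by rewrite !mxE (inj_eq enum_val_inj).
Qed.

Lemma fun_mx_mul (R : comNzRingType) (U V W : finType)
    (F : U -> V -> R) (G : V -> W -> R) :
  fun_mx F *m fun_mx G = fun_mx (fun u w => \sum_v F u v * G v w).
Proof.
apply/matrixP => i j; rewrite !mxE [RHS](reindex _ (onW_bij _ (enum_val_bij _))).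
by apply: eq_bigr => k _; rewrite !mxE.
Qed.

Lemma fun_mxB (R : comNzRingType) (U V : finType) (a : R) (F G : U -> V -> R) :
  a *: fun_mx F - fun_mx G = fun_mx (fun u v => a * F u v - G u v).
Proof. by apply/matrixP => i j; rewrite !mxE. Qed.

(** The entry of [B^T B] at [y], [y'] counts the points above both, so the
Schur complement of the scalar block is diagonal. The fibres of [f] are the
leaves of the stars. The free parameters [a], [b], [d] let one identity serve
for all the characteristic matrices of the star forest. *)
Lemma det_star_forest (R : comNzRingType) (X Y : finType)
    (f : X -> Y) (a b : R) (d : Y -> R) :
  a ^+ #|Y| * \det (fun_mx (sum_block (fun x x' => a *+ (x == x'))
     (fun x y => b *+ (f x == y)) (fun y x => b *+ (f x == y))
     (fun y y' => d y *+ (y == y'))))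
  = a ^+ #|X| * \prod_y (a * d y - b ^+ 2 *+ #|[set x | f x == y]|).
Proof.
rewrite det_sum_block fun_mx_scalar det_block_scalar_ul fun_mx_mul fun_mxB.
rewrite -det_fun_diag; congr (_ * \det _).
apply/matrixP => i j; rewrite !mxE.
set u := enum_val i; set v := enum_val j.
transitivity (a * (d u *+ (u == v)) - b ^+ 2 *+ #|[set x | f x == u & f x == v]|).
  congr (_ - _); rewrite -sumr_const [RHS]big_mkcond; apply: eq_bigr => x _.
  by rewrite inE; do 2?case: eqP => _; rewrite /= ?mulr0n ?mulr1n ?(mul0r, mulr0).
case: (eqVneq u v) => [<-|neq_uv] /=.
  by congr (_ - _ *+ _); apply: eq_card => x; rewrite !inE andbb.
rewrite mulr0n mulr0 eq_card0 ?subr0 // => x.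
by rewrite !inE; apply/negP => /andP[/eqP-> /eqP eq_uv]; rewrite eq_uv eqxx in neq_uv.
Qed.

(** The matrix with entries [f x == f x'] is [B B^T], and [a I - B B^T] is the
Schur complement of the identity block in the matrix of [det_star_forest] with
[b = d = 1]. *)
Lemma det_same_fibre (R : comNzRingType) (X Y : finType) (f : X -> Y) (a e : R) :
  a ^+ #|Y| * \det (fun_mx (sum_block (fun x x' => a *+ (x == x') - (f x == f x')%:R)
     (fun _ _ => 0) (fun _ _ => 0)
     (fun y y' : Y => e *+ (y == y'))))
  = a ^+ #|X| * e ^+ #|Y| * \prod_y (a - #|[set x | f x == y]|%:R).
Proof.
rewrite det_sum_block fun_mx_scalar.
have fun_mx0 (U V : finType) : fun_mx (fun (_ : U) (_ : V) => 0) = 0 :> 'M[R]_(_, _).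
  by apply/matrixP => i j; rewrite !mxE.
rewrite !fun_mx0 det_ublock det_scalar mulrA [RHS]mulrAC; congr (_ * _).
have := det_star_forest f a 1 (fun=> 1).
under [in RHS]eq_bigr do rewrite mulr1 expr1n.
rewrite det_sum_block !fun_mx_scalar det_block_1_dr fun_mx_mul -fun_mx_scalar => <-.
congr (_ * \det _); apply/matrixP => i j; rewrite !mxE; congr (_ - _).
rewrite (bigD1 (f (enum_val i))) //= eqxx mul1r big1 ?addr0 => [|y].
  by rewrite eq_sym.
by rewrite eq_sym => /negPf->; rewrite mul0r.
Qed.

(** Gives the characteristic matrix its entries in a chosen form [F'], so that
it can be put in block form without computing the matrix itself. *)
Lemma char_poly_fun_mx (R : comNzRingType) (V : finType)
    (F : V -> V -> R) (F' : V -> V -> {poly R}) :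
    (forall v w, F' v w = 'X *+ (v == w) - (F v w)%:P) ->
  char_poly (fun_mx F) = \det (fun_mx F').
Proof.
move=> defF'; congr (\det _); apply/matrixP => i j; rewrite !mxE defF'.
by rewrite (inj_eq enum_val_inj).
Qed.

(** * Characteristic polynomials of the subgroup generating graph *)

(** The centre of the star to which the pair belongs. *)
Definition gen_pair (gT : finGroupType) (u : gT * gT) : {group gT} :=
  <<[set u.1; u.2]>>%G.

Definition nb_gen_pairs (gT : finGroupType) (H : {group gT}) : nat :=
  #|[set u | gen_pair u == H]|.

Lemma sgb_edgeE (gT : finGroupType) :
  ((forall u w, @edge (sgb_graph gT) (inl u) (inl w) = false)
  * (forall u H, @edge (sgb_graph gT) (inl u) (inr H) = (gen_pair u == H))
  * (forall H u, @edge (sgb_graph gT) (inr H) (inl u) = (gen_pair u == H))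
  * (forall H K, @edge (sgb_graph gT) (inr H) (inr K) = false))%type.
Proof.
split; [split; [split|]|].
- by move=> [a b] [c d].
- by move=> [a b] H; rewrite /= eq_sym -val_eqE.
- by move=> H [a b]; rewrite /= eq_sym -val_eqE.
- by [].
Qed.

Lemma degree_pair (gT : finGroupType) (u : gT * gT) :
  @degree (sgb_graph gT) (inl u) = 1%N.
Proof.
rewrite -(cards1 (inr (gen_pair u) : vertex (sgb_graph gT))).
congr #|pred_of_set _|; apply/setP => -[w|H]; rewrite !inE sgb_edgeE //.
by rewrite eq_sym.
Qed.

Lemma degree_subgroup (gT : finGroupType) (H : {group gT}) :
  @degree (sgb_graph gT) (inr H) = nb_gen_pairs H.
Proof.
have inl_inj : injective (inl : gT * gT -> vertex (sgb_graph gT)) by move=> ? ? [].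
rewrite /degree /nb_gen_pairs -(card_imset _ inl_inj).
congr #|pred_of_set _|; apply/setP => -[w|K].
  by rewrite (mem_imset _ _ inl_inj) !inE sgb_edgeE.
by rewrite !inE sgb_edgeE; apply/esym/negbTE/imsetP => -[].
Qed.

Lemma card_common_nbr_pairs (gT : finGroupType) (u w : gT * gT) :
  #|@common_nbr (sgb_graph gT) (inl u) (inl w)| = (gen_pair u == gen_pair w).
Proof.
case: (eqVneq (gen_pair u) (gen_pair w)) => [eq_uw|neq_uw].
  apply: etrans (cards1 (inr (gen_pair u) : vertex (sgb_graph gT))).
  congr #|pred_of_set _|; apply/setP => -[v|H]; rewrite !inE !sgb_edgeE ?andbF //=.
  by rewrite -eq_uw andbb eq_sym.
apply/eqP; rewrite cards_eq0; apply/eqP/setP => -[v|H];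
  rewrite !inE !sgb_edgeE ?andbF //=.
by apply/negP => /andP[/eqP eq_u /eqP eq_w]; rewrite eq_u eq_w eqxx in neq_uw.
Qed.

Lemma card_common_nbr_subgroups (gT : finGroupType) (H K : {group gT}) :
  H != K -> #|@common_nbr (sgb_graph gT) (inr H) (inr K)| = 0%N.
Proof.
move=> neq_HK; apply/eqP; rewrite cards_eq0; apply/eqP/setP => -[v|L];
  rewrite !inE !sgb_edgeE ?andbF //=.
by apply/negP => /andP[/eqP eq_H /eqP eq_K]; rewrite -eq_H -eq_K eqxx in neq_HK.
Qed.

Lemma card_common_nbr_pair_subgroup (gT : finGroupType) (u : gT * gT) (H : {group gT}) :
  (#|@common_nbr (sgb_graph gT) (inl u) (inr H)| = 0%N)
  * (#|@common_nbr (sgb_graph gT) (inr H) (inl u)| = 0%N).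
Proof.
by split; apply/eqP; rewrite cards_eq0; apply/eqP/setP => -[v|K];
  rewrite !inE !sgb_edgeE !andbF.
Qed.

Lemma char_adj_sgb (C : numClosedFieldType) (gT : finGroupType) :
  'X ^+ #|{group gT}| * char_poly (adj_mx C (sgb_graph gT)) =
  'X ^+ (#|gT| ^ 2) * \prod_(H : {group gT}) ('X ^+ 2 - (nb_gen_pairs H)%:R).
Proof.
have -> : char_poly (adj_mx C (sgb_graph gT)) = \det (fun_mx (sum_block
    (fun u w : gT * gT => 'X *+ (u == w))
    (fun u (H : {group gT}) => (-1) *+ (gen_pair u == H))
    (fun H u => (-1) *+ (gen_pair u == H))
    (fun H K : {group gT} => 'X *+ (H == K)))).
  apply: (@char_poly_fun_mx _ (vertex (sgb_graph gT)) (fun v w => (edge v w)%:R))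
    => -[u|H] [w|K]; rewrite sgb_edgeE /= ?subr0 //.
    by rewrite sub0r mulNrn polyC_natr.
  by rewrite sub0r mulNrn polyC_natr.
rewrite det_star_forest card_prod -mulnn; congr (_ * _); apply: eq_bigr => H _.
by rewrite sqrrN expr1n.
Qed.

(** The sign [s] treats [D - A] and [D + A] together: the determinant depends on
it through its square only, since the graph is bipartite. Each factor comes
from [('X - 1) * ('X - n) - n = 'X * ('X - (n + 1))]. *)
Lemma char_signed_lap_sgb (C : numClosedFieldType) (gT : finGroupType) (s : C) :
    s ^+ 2 = 1 ->
  ('X - 1) ^+ #|{group gT}|
    * char_poly (deg_mx C (sgb_graph gT) + s *: adj_mx C (sgb_graph gT)) =
  ('X - 1) ^+ (#|gT| ^ 2)
    * \prod_(H : {group gT}) ('X * ('X - (nb_gen_pairs H).+1%:R)).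
Proof.
move=> s2_1.
have -> : deg_mx C (sgb_graph gT) + s *: adj_mx C (sgb_graph gT) = fun_mx
    (fun v w : vertex (sgb_graph gT) => (degree v)%:R *+ (v == w) + s * (edge v w)%:R).
  by apply/matrixP => i j; rewrite !mxE (inj_eq enum_val_inj).
have -> : char_poly (fun_mx
      (fun v w : vertex (sgb_graph gT) =>
        (degree v)%:R *+ (v == w) + s * (edge v w)%:R))
  = \det (fun_mx (sum_block
    (fun u w : gT * gT => ('X - 1) *+ (u == w))
    (fun u (H : {group gT}) => (- s%:P) *+ (gen_pair u == H))
    (fun H u => (- s%:P) *+ (gen_pair u == H))
    (fun H K : {group gT} => ('X - (nb_gen_pairs H)%:R) *+ (H == K)))).
  apply: (@char_poly_fun_mx _ (vertex (sgb_graph gT))) => -[u|H] [w|K];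
    rewrite sgb_edgeE ?degree_pair ?degree_subgroup /=.
  - by rewrite mulr0 addr0 mulrnBl polyCMn polyC_natr.
  - by rewrite !mulr0n !sub0r add0r mulr_natr polyCMn mulNrn.
  - by rewrite !mulr0n !sub0r add0r mulr_natr polyCMn mulNrn.
  - by rewrite mulr0 addr0 mulrnBl polyCMn polyC_natr.
rewrite det_star_forest card_prod -mulnn; congr (_ * _); apply: eq_bigr => H _.
rewrite sqrrN -polyC_exp s2_1 -/(nb_gen_pairs H) -natr1.
by ring.
Qed.

(** The factor ['X ^+ #|{group gT}|] on the right comes from the subgroups, which
have no common neighbour with any other vertex. *)
Lemma char_cn_sgb (C : numClosedFieldType) (gT : finGroupType) :
  ('X + 1) ^+ #|{group gT}| * char_poly (cn_mx C (sgb_graph gT)) =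
  ('X + 1) ^+ (#|gT| ^ 2) * 'X ^+ #|{group gT}|
    * \prod_(H : {group gT}) ('X + 1 - (nb_gen_pairs H)%:R).
Proof.
have -> : cn_mx C (sgb_graph gT) =
    fun_mx (fun v w : vertex (sgb_graph gT) =>
      if v == w then 0 else #|common_nbr v w|%:R).
  by apply/matrixP => i j; rewrite !mxE (inj_eq enum_val_inj).
have -> : char_poly (fun_mx (fun v w : vertex (sgb_graph gT) =>
     if v == w then 0 else #|common_nbr v w|%:R : C)) = \det (fun_mx (sum_block
    (fun u w : gT * gT => ('X + 1) *+ (u == w) - (gen_pair u == gen_pair w)%:R)
    (fun _ _ => 0) (fun _ _ => 0) (fun H K : {group gT} => 'X *+ (H == K)))).
  apply: (@char_poly_fun_mx _ (vertex (sgb_graph gT))) => -[u|H] [w|K] /=.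
  - rewrite card_common_nbr_pairs -[inl u == inl w]/(u == w).
    by case: eqVneq => [->|_] /=; rewrite ?eqxx ?mulr0n ?subr0 ?addrK // polyC_natr.
  - by rewrite card_common_nbr_pair_subgroup subr0.
  - by rewrite card_common_nbr_pair_subgroup subr0.
  - rewrite -[inr H == inr K]/(H == K).
    by case: eqVneq => [_|/card_common_nbr_subgroups->]; rewrite subr0.
by rewrite det_same_fibre card_prod -mulnn.
Qed.

(** * Subgroups of a dihedral group of order twice a prime *)

(** For [q > 2] the group in question is that of the rotations; when [q = 2] it
may be any one of the three subgroups of order two. An element outside it is a
product [u * y] of a rotation and a fixed reflection, and [y] inverts [u]. *)
Lemma dihedral_rotations (q : nat) (gT : finGroupType) :
    (1 < q)%N -> [set: gT] \isog 'D_(2 * q) ->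
  exists P : {group gT},
    [/\ #|P| = q, #|gT| = (2 * q)%N & forall x, x \notin P -> #[x]%g = 2].
Proof.
move=> q_gt1; rewrite mul2n => isoD.
have [oG] := isoGrpP [set: gT]%G (Grp_dihedral q_gt1) isoD.
rewrite card_dihedral // cardsT in oG.
case/existsP => -[x y] /=; rewrite !xpair_eqE.
case/and4P=> /eqP defG /eqP xq /eqP y2 /eqP xy.
have y_norm : <[y]>%g \subset 'N(<[x]>)%g by rewrite norms_cycle xy groupV cycle_id.
have defxy : (<[x]> * <[y]> = [set: gT])%g.
  by rewrite -norm_joinEr // defG.
have ox_dvd : (#[x]%g %| q)%N by rewrite order_dvdn xq.
have oy_dvd : (#[y]%g %| 2)%N by rewrite order_dvdn y2.
have le_xy : (2 * q <= #[x]%g * #[y]%g)%N.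
  by rewrite mul2n -oG -cardsT -defxy /order mul_cardG leq_pmulr ?cardG_gt0.
have q_gt0 : (0 < q)%N by apply: ltnW.
exists <[x]>%G; split=> [||z]; last 1 first.
- move=> z_notin; apply: nt_prime_order => //; last by apply: contraNneq z_notin => ->.
  have /mulsgP[u v u_in v_in def_z] : z \in (<[x]> * <[y]>)%g by rewrite defxy inE.
  have /cycleP[k def_v] := v_in.
  (* An even power of [y] is trivial, and would put [z] among the rotations. *)
  have {k} {}def_v : v = y.
    rewrite def_v -[k]odd_double_half expgD -mul2n expgM y2 expg1n mulg1.
    case: (boolP (odd k)) => // /negPf even_k; case/negP: z_notin.
    by rewrite def_z def_v -[k]odd_double_half even_k -mul2n expgM y2 expg1n mulg1.
  have /cycleP[i def_u] := u_in.
  have yV : (y^-1 = y)%g by apply/eqP; rewrite eq_invg_mul -y2.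
  have uy : (u ^ y = u^-1)%g by rewrite def_u conjXg xy expgVn.
  rewrite def_z def_v expgS expg1 -!mulgA.
  have -> : (y * (u * y) = u ^ y)%g by rewrite conjgE yV.
  by rewrite uy mulgV.
- apply/eqP; rewrite eqn_leq (dvdn_leq q_gt0 ox_dvd) -(leq_pmul2l (isT : (0 < 2)%N)).
  by rewrite (leq_trans le_xy) // mulnC leq_mul2r (dvdn_leq _ oy_dvd) ?orbT.
- by [].
Qed.

(** Let [H] be different from [1], [P] and the whole group. If [H] contained [P],
its order would be a multiple of [p] dividing [2 p], which only leaves [P] and
the whole group. So [H] meets [P] trivially, and comparing the order of [P H]
with that of the group shows that [H] has order two. The generator of such an
[H] is its only nontrivial element, so distinct reflections generate distinct
subgroups. Being stated for any commutative law, the result serves to count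
subgroups, to add up the numbers of generating pairs, and to expand the
products over subgroups. *)
Lemma big_subgroups_index2 (T : Type) (idx : T) (op : Monoid.com_law idx)
    (p : nat) (gT : finGroupType) (P : {group gT}) (F : {group gT} -> T) :
    prime p -> #|P| = p -> #|gT| = (2 * p)%N ->
    (forall x, x \notin P -> #[x]%g = 2) ->
  \big[op/idx]_(H : {group gT}) F H =
  op (op (op (F 1%G) (F P)) (F [set: gT]%G)) (\big[op/idx]_(x | x \notin P) F <[x]>%G).
Proof.
move=> p_prime oP oG invol.
have p_gt1 := prime_gt1 p_prime; have p_gt0 := ltnW p_gt1.
have P_neq1 : P != 1%G by rewrite -cardG_gt1 oP.
have T_neq1 : [set: gT]%G != 1%G by rewrite -cardG_gt1 cardsT oG; lia.
have T_neqP : [set: gT]%G != P.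
  by apply/eqP => /(congr1 (fun H : {group gT} => #|H|)); rewrite /= cardsT oG oP; lia.
have cycle_invol x : x \notin P ->
    [&& <[x]>%G != 1%G, <[x]>%G != P & <[x]>%G != [set: gT]%G].
  move=> x_notin; have ox : #|<[x]>%G| = 2 by rewrite -(invol x) // orderE.
  apply/and3P; split.
  - by rewrite -cardG_gt1 ox.
  - by apply: contraNneq x_notin => <-; apply: cycle_id.
  - apply/eqP => /(congr1 (fun H : {group gT} => #|H|)); rewrite ox /= cardsT oG; lia.
have cycle_inj : {in [pred x | x \notin P] &, injective (fun x => <[x]>%G)}.
  move=> x y; rewrite !inE => x_notin y_notin /(congr1 (fun H : {group gT} => x \in H)).
  rewrite /= cycle_id cycle2g ?invol // !inE => /esym/orP[/eqP x1|/eqP//].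
  by rewrite x1 group1 in x_notin.
rewrite (bigD1 1%G) // (bigD1 P) //= (bigD1 [set: gT]%G) ?T_neq1 //=.
rewrite !Monoid.mulmA; congr (op _ _).
rewrite -(big_imset (A := [pred x | x \notin P]) F cycle_inj) /=.
apply: eq_bigl => H; apply/idP/imsetP; last first.
  by case=> x x_notin ->; rewrite -andbA cycle_invol.
case/andP=> /andP[H_neq1 H_neqP] H_neqT.
have not_sPH : ~~ (P \subset H).
  apply: contra H_neqT => sPH; rewrite -val_eqE eqEcard subsetT /= cardsT oG.
  have /dvdnP[k oH] := cardSg sPH; rewrite oP in oH.
  rewrite oH leq_mul2r; case: (ltnP 1 k) => [_|k_le1]; rewrite ?orbT //.
  case/eqP: H_neqP; apply/val_inj/esym/eqP; rewrite eqEcard sPH oH oP /=.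
  by rewrite -[leqRHS]mul1n leq_mul2r k_le1 orbT.
have TI_PH : (P :&: H = 1)%g by apply: prime_TIg; rewrite ?oP.
have oH_le2 : (#|H| <= 2)%N.
  rewrite -(leq_pmul2l p_gt0) -{1}oP mul_cardG TI_PH cards1 muln1 mulnC -oG.
  exact: max_card.
have /trivgPn[x x_in x_neq1] : H != 1%g :> {set gT} by [].
have x_notin : x \notin P.
  apply: contra x_neq1 => xP.
  have : x \in P :&: H by rewrite inE xP.
  by rewrite TI_PH inE.
exists x => //; apply/val_inj/esym/eqP.
by rewrite eqEcard cycle_subG x_in -orderE invol.
Qed.

(** * Counting generating pairs *)

Lemma nb_gen_pairs1 (gT : finGroupType) : nb_gen_pairs (1%G : {group gT}) = 1%N.
Proof.
rewrite /nb_gen_pairs -(cards1 (1%g : gT, 1%g : gT)).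
congr #|pred_of_set _|; apply/setP => -[a b]; rewrite !inE -val_eqE /= xpair_eqE.
by rewrite -subG1 gen_subG subUset !sub1set !inE.
Qed.

(** The only proper subgroup is trivial, and only the pair of identities
generates it. *)
Lemma nb_gen_pairs_prime (gT : finGroupType) (H : {group gT}) :
  prime #|H| -> nb_gen_pairs H = (#|H| ^ 2 - 1)%N.
Proof.
move=> H_prime.
have -> : nb_gen_pairs H = #|setX H H :\ (1%g, 1%g)|; last first.
  rewrite -mulnn -cardsX (cardsD1 (1%g, 1%g) (setX H H)) in_setX !group1.
  by rewrite addKn.
congr #|pred_of_set _|; apply/setP => -[a b]; rewrite !inE xpair_eqE /=.
apply/eqP/andP => [defH|[ab_neq1 /andP[aH bH]]].
  have [aH bH] : a \in H /\ b \in H by rewrite -defH !mem_gen ?inE ?eqxx ?orbT.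
  rewrite aH bH; split=> //; apply/negP => /andP[/eqP a1 /eqP b1].
  by rewrite -defH /= a1 b1 setUid (genGid 1%G) cards1 in H_prime.
have sKH : gen_pair (a, b) \subset H by rewrite gen_subG subUset !sub1set aH.
apply/val_inj/eqP; rewrite eqEcard sKH /=.
have /primeP[_ /(_ _ (cardSg sKH))/orP[|/eqP->//]] := H_prime.
rewrite -trivg_card1 -subG1 gen_subG subUset !sub1set !inE /=.
by rewrite (negPf ab_neq1).
Qed.

Lemma sum_nb_gen_pairs (gT : finGroupType) :
  (\sum_(H : {group gT}) nb_gen_pairs H = #|gT| ^ 2)%N.
Proof.
rewrite -mulnn -card_prod -cardsT -sum1_card.
rewrite (partition_big (@gen_pair gT) xpredT) //=; apply: eq_bigr => H _.
by rewrite sum1dep_card; apply: eq_card => u; rewrite !inE.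
Qed.

(** The number of pairs is written as the number of subgroups plus the
multiplicity [4 p^2 - p - 3] of the eigenvalue that comes from the leaves, which
is the form in which [cancel_expr] uses it. The number of
pairs generating the whole group is obtained by difference from the total. *)
Lemma sgb_dihedral (p : nat) (gT : finGroupType) :
    prime p -> [set: gT] \isog 'D_(2 * p) ->
  [/\ (#|gT| ^ 2 = #|{group gT}| + (4 * p ^ 2 - p - 3))%N,
      #|{group gT}| = (p + 3)%N &
      forall (R : comNzRingType) (F : nat -> R),
      \prod_(H : {group gT}) F (nb_gen_pairs H) =
        F 1%N * F (p ^ 2 - 1)%N * F (3 * p ^ 2 - 3 * p)%N * F 3%N ^+ p].
Proof.
move=> p_prime isoD; have p_gt1 := prime_gt1 p_prime.
have [P [oP oG invol]] := dihedral_rotations p_gt1 isoD.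
have card_notP : #|[pred x | x \notin P]| = p.
  by have := cardC (mem P); rewrite oP oG mul2n -addnn => /addnI.
have nbP : nb_gen_pairs P = (p ^ 2 - 1)%N by rewrite nb_gen_pairs_prime oP.
have nb_invol x : x \notin P -> nb_gen_pairs <[x]>%G = 3.
  by move=> /invol ox; rewrite nb_gen_pairs_prime /= -orderE ox.
have nbT : nb_gen_pairs [set: gT]%G = (3 * p ^ 2 - 3 * p)%N.
  have := sum_nb_gen_pairs gT.
  rewrite (big_subgroups_index2 _ _ p_prime oP oG invol) /= nb_gen_pairs1 nbP oG.
  rewrite (eq_bigr _ nb_invol) sum_nat_const card_notP.
  nia.
have oL : #|{group gT}| = (p + 3)%N.
  rewrite -sum1_card (big_subgroups_index2 _ _ p_prime oP oG invol) /=.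
  by rewrite sum1_card card_notP addnC.
split=> // [|R F]; first by rewrite oL oG; nia.
rewrite (big_subgroups_index2 _ _ p_prime oP oG invol) /= nb_gen_pairs1 nbP nbT.
by rewrite (eq_bigr (fun=> F 3)) ?prodr_const ?card_notP // => x /nb_invol->.
Qed.

(** * Multisets of eigenvalues *)

Lemma eigenvalues_mset_pow (C : numClosedFieldType) n (A : 'M[C]_n)
    (s : seq (C * nat)) :
    char_poly A = \prod_(xn <- s) ('X - xn.1%:P) ^+ xn.2 ->
  eigenvalues A = mset_pow s.
Proof.
move=> charA; apply/eigenvaluesP; rewrite charA big_flatten big_map.
by apply: eq_bigr => -[x m] _; rewrite big_nseq -Monoid.iteropE.
Qed.

Lemma subr_sqr_sqrtC (C : numClosedFieldType) (n : C) :
  'X ^+ 2 - n%:P = ('X - (sqrtC n)%:P) * ('X - (- sqrtC n)%:P).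
Proof. by rewrite polyCN opprK -subr_sqr -polyC_exp sqrtCK. Qed.

Lemma cancel_expr (R : idomainType) (a r s : R) k m :
  a != 0 -> a ^+ k * r = a ^+ (k + m) * s -> r = a ^+ m * s.
Proof. by move=> a_neq0; rewrite exprD -mulrA => /mulfI->; rewrite // expf_neq0. Qed.

(* 'D_n is the dihedral group of order n. *)
Theorem theorem3p1 (C : numClosedFieldType) (p : nat) (gT : finGroupType)
    (p_prime : prime p) (gT_dihedral : [set: gT] \isog 'D_(2 * p)) :
  [/\ spec C (sgb_graph gT) =
        mset_pow [:: (0, (4 * p ^ 2 - p - 3)%N);
                     (-1, 1%N);
                     (1, 1%N);
                     (sqrtC 3, p);
                     (- sqrtC 3, p);
                     (sqrtC (p%:R ^+ 2 - 1), 1%N);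
                     (- sqrtC (p%:R ^+ 2 - 1), 1%N);
                     (sqrtC (3 * p%:R ^+ 2 - 3 * p%:R), 1%N);
                     (- sqrtC (3 * p%:R ^+ 2 - 3 * p%:R), 1%N)],
      Lspec C (sgb_graph gT) =
        mset_pow [:: (0, (p + 3)%N);
                     (1, (4 * p ^ 2 - p - 3)%N);
                     (2, 1%N);
                     (4, p);
                     (p%:R ^+ 2, 1%N);
                     (3 * p%:R ^+ 2 - 3 * p%:R + 1, 1%N)],
      Qspec C (sgb_graph gT) =
        mset_pow [:: (0, (p + 3)%N);
                     (1, (4 * p ^ 2 - p - 3)%N);
                     (2, 1%N);
                     (4, p);
                     (p%:R ^+ 2, 1%N);
                     (3 * p%:R ^+ 2 - 3 * p%:R + 1, 1%N)] &
      CNspec C (sgb_graph gT) =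
        mset_pow [:: (0, (p + 4)%N);
                     (-1, (4 * p ^ 2 - p - 3)%N);
                     (2, p);
                     (p%:R ^+ 2 - 2, 1%N);
                     (3 * p%:R ^+ 2 - 3 * p%:R - 1, 1%N)]].
Proof.
have p_gt1 := prime_gt1 p_prime.
have [cardG cardL prodL] := sgb_dihedral p_prime gT_dihedral.
set m := (4 * p ^ 2 - p - 3)%N in cardG *.
set nP : C := p%:R ^+ 2 - 1; set nT : C := 3 * p%:R ^+ 2 - 3 * p%:R.
have castP : (p ^ 2 - 1)%:R = nP by rewrite natrB ?natrX //; lia.
have castT : (3 * p ^ 2 - 3 * p)%:R = nT by rewrite natrB ?natrM ?natrX //; nia.
(* The sign [s] is [-1] for the Laplacian and [1] for the signless one. *)
have lap s : s ^+ 2 = 1 ->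
  eigenvalues (deg_mx C (sgb_graph gT) + s *: adj_mx C (sgb_graph gT)) =
  mset_pow [:: (0, (p + 3)%N); (1, m); (2, 1%N); (4, p);
               (p%:R ^+ 2, 1%N); (nT + 1, 1%N)].
  move=> /(@char_signed_lap_sgb _ gT s); rewrite cardG => /cancel_expr char_lap.
  apply: eigenvalues_mset_pow; rewrite char_lap ?polyXsubC_eq0 //.
  rewrite (prodL _ (fun n => 'X * ('X - n.+1%:R))) -!polyC_natr.
  rewrite -[(p ^ 2 - 1).+1%:R]natr1 -[(3 * p ^ 2 - 3 * p).+1%:R]natr1 castP castT subrK.
  rewrite !big_cons big_nil /= subr0 exprD exprMn.
  ring.
split.
- apply: eigenvalues_mset_pow.
  have := char_adj_sgb C gT; rewrite cardG => /cancel_expr->; rewrite ?polyX_eq0 //.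
  rewrite (prodL _ (fun n => 'X ^+ 2 - n%:R)) -!polyC_natr castP castT.
  rewrite !subr_sqr_sqrtC sqrtC1 exprMn !big_cons big_nil /= subr0.
  ring.
- by rewrite /Lspec -(lap (-1)) ?scaleN1r // sqrrN expr1n.
- by rewrite /Qspec -(lap 1) ?scale1r // expr1n.
- apply: eigenvalues_mset_pow.
  have := char_cn_sgb C gT; rewrite cardG -mulrA => /cancel_expr->; last first.
    by rewrite -[1]opprK -polyCN polyXsubC_eq0.
  rewrite (prodL _ (fun n => 'X + 1 - n%:R)) -!polyC_natr castP castT cardL.
  rewrite !big_cons big_nil /= polyCN opprK subr0.
  rewrite (_ : 'X + 1 - 3%:P = 'X - 2%:P); last by ring.
  rewrite polyC1 /nP !exprD.
  ring.
Qed.
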